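(* Let $\mathbb{k}$ be a field and $n\ge2$. The quotient pseudo-distance $d_{\mathbf{X}}$ on $\mathbf{X}_n$ is a distance, and $\mathbf{X}_n$ equipped with this distance is a length space.
   Context: $\mathrm{Aut}(\mathbb{k}^n)$ is the group (under composition) of polynomial automorphisms $g=(g_1,\dots,g_n)$, $g_i\in\mathbb{k}[x_1,\dots,x_n]$, of affine $n$-space. $\mathrm{Tame}(\mathbb{k}^n)$ is the subgroup generated by $\mathrm{GL}_n(\mathbb{k})$ and the elementary automorphisms $(x_1,\dots,x_n)\mapsto(x_1+P(x_2,\dots,x_n),x_2,\dots,x_n)$. For $g\in\mathrm{Aut}(\mathbb{k}^n)$ and a polynomial $P$, $g^*P:=P(g_1,\dots,g_n)$; the group acts on the left on valuations $\nu:\mathbb{k}[x_1,\dots,x_n]\to\mathbb{R}\cup\{+\infty\}$ by $(g\cdot\nu)(P)=\nu(g^*P)$, and hence on classes of valuations modulo multiplication by positive reals. Let $\Pi=\{\alpha\in\mathbb{R}^n:\alpha_i>0\ \forall i\}$ and $\Pi^+=\{\alpha\in\Pi:\alpha_1\ge\dots\ge\alpha_n\}$; let $[\alpha]$ be the class of $\alpha$ modulo positive scaling, and let $\nabla$, $\nabla^+$ be the sets of classes of $\Pi$, $\Pi^+$. For $\alpha\in\Pi$ set $\nu_{\mathrm{id},\alpha}\big(\sum_I c_Ix_1^{i_1}\cdots x_n^{i_n}\big)=\min_{I:\,c_I\ne0}\big(-\sum_k\alpha_ki_k\big)$ (and $+\infty$ for the zero polynomial), and $\nu_{f,\alpha}=f\cdot\nu_{\mathrm{id},\alpha}$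 for $f\in\mathrm{Tame}(\mathbb{k}^n)$; the class of $\nu_{f,\alpha}$ modulo positive scaling depends only on $[\alpha]$ and is denoted $\nu_{f,[\alpha]}$. $\mathbf{X}_n=\{\nu_{f,[\alpha]}: f\in\mathrm{Tame}(\mathbb{k}^n),[\alpha]\in\nabla\}$. The chamber of $f$ is $\mathbf{E}^+_f=\{\nu_{f,[\alpha]}:[\alpha]\in\nabla^+\}$; the chambers cover $\mathbf{X}_n$ and $[\alpha]\mapsto\nu_{f,[\alpha]}$ is a bijection $\nabla^+\to\mathbf{E}_f^+$. Pseudo-distance: represent each $[\alpha]\in\nabla$ by the representative with $\prod\alpha_i=1$ and put $\beta_i=\log\alpha_i$; this identifies $\nabla$ with $\{\beta\in\mathbb{R}^n:\sum\beta_i=0\}\cong\mathbb{R}^{n-1}$, and $|\cdot,\cdot|$ is the induced Euclidean distance on $\nabla\supset\nabla^+$. Transport it to each chamber $\mathbf{E}_f^+$ via $[\alpha]\mapsto\nu_{f,[\alpha]}$. For $x,y\in\mathbf{X}_n$, $d_{\mathbf{X}}(x,y)$ is the infimum of $\sum_{i=0}^{k-1}|y_i,y_{i+1}|$ over all $k$ and all finite sequences $x=y_0,y_1,\dots,y_k=y$ in $\mathbf{X}_n$ together with $f_0,\dots,f_{k-1}\in\mathrm{Tame}(\mathbb{k}^n)$ such that $y_i,y_{i+1}\in\mathbf{E}^+_{f_i}$, the distance $|y_i,y_{i+1}|$ being measured in $\mathbf{E}^+_{f_i}$. (That is, $d_{\mathbf X}$ is the quotient pseudo-distance when $\mathbf{X}_n$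 is viewed as the quotient of the disjoint union of the chambers $\mathbf{E}_f^+$.) *)

(* Defs.v *)
From HB Require Import structures.
From mathcomp Require Import all_boot all_order all_algebra.
From mathcomp Require Import all_classical all_reals all_analysis.
From mathcomp Require mpoly.
(* The notations of [mpoly] clash with those of the analysis library, hence
   [mpoly n k] below for the ring of polynomials in [n] variables over [k]. *)
Import -(notations) mpoly.
Set Implicit Arguments.
Unset Strict Implicit.
Unset Printing Implicit Defensive.
Import Order.TTheory GRing.Theory Num.Theory.
Local Open Scope classical_set_scope.
Local Open Scope ring_scope.

Section PolynomialMaps.
Variables (k : fieldType) (n : nat).

Definition polymap := n.-tuple (mpoly n k).

Definition polyvar (i : 'I_n) : mpoly n k := mpolyX k (mnm1 i).

(* [g^* P = P(g_1, ..., g_n)] *)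
Definition pullback (g : polymap) (P : mpoly n k) : mpoly n k := comp_mpoly g P.

Definition id_map : polymap := [tuple polyvar i | i < n].

Definition comp_map (g h : polymap) : polymap :=
  [tuple pullback h (tnth g i) | i < n].

Definition mutually_inverse (g h : polymap) : Prop :=
  comp_map g h = id_map /\ comp_map h g = id_map.

Definition is_polyaut (g : polymap) : Prop := exists h, mutually_inverse g h.

Definition linear_map (A : 'M[k]_n) : polymap :=
  [tuple \sum_(j < n) A i j *: polyvar j | i < n].

(* [x_1] is the variable of index [0]. *)
Definition free_of_x1 (P : mpoly n k) : Prop :=
  forall (m : multinom n) (i : 'I_n), m \in msupp P -> val i = 0%N -> m i = 0%N.

Definition elementary_map (P : mpoly n k) : polymap :=
  [tuple if val i == 0%N then polyvar i + P else polyvar i | i < n].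

Definition is_subgroup_of_Aut (H : set polymap) : Prop :=
  [/\ H `<=` is_polyaut,
      H id_map,
      forall g h, H g -> H h -> H (comp_map g h)
    & forall g h, H g -> mutually_inverse g h -> H h].

Definition tame_generators : set polymap :=
  [set linear_map A | A in [set A | A \in unitmx]] `|`
  [set elementary_map P | P in free_of_x1].

Definition Tame : set polymap :=
  [set f | forall H : set polymap,
     is_subgroup_of_Aut H -> tame_generators `<=` H -> H f].

End PolynomialMaps.

Section Valuations.
Variables (k : fieldType) (n : nat) (R : realType).

Definition valuation := mpoly n k -> \bar R.

Definition Pi : set 'rV[R]_n := [set a | forall i, 0 < a 0 i].

Definition Pi_plus : set 'rV[R]_n :=
  [set a | Pi a /\ forall i j : 'I_n, (i <= j)%N -> a 0 j <= a 0 i].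

(* The support of the zero polynomial is empty, which gives [+oo]. *)
Definition nu_id (a : 'rV[R]_n) : valuation := fun P =>
  \big[Order.min/+oo%E]_(m <- msupp P) (- \sum_(i < n) a 0 i * (m i)%:R)%:E.

Definition act (g : polymap k n) (v : valuation) : valuation :=
  fun P => v (pullback g P).

Definition nu (f : polymap k n) (a : 'rV[R]_n) : valuation := act f (nu_id a).

(* Classes modulo positive scaling are encoded as the sets of their elements. *)
Definition valclass := set valuation.

Definition class_of (v : valuation) : valclass :=
  [set w | exists2 c : R, 0 < c & w = (fun P => c%:E * v P)%E].

Definition X : set valclass :=
  [set x | exists f a, [/\ Tame f, Pi a & x = class_of (nu f a)]].

(* The representative with product [1] of the class of [a]. *)
Definition unit_rep (a : 'rV[R]_n) : 'rV[R]_n :=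
  (((\prod_(i < n) a 0 i) `^ n%:R^-1)^-1) *: a.

(* The Euclidean distance on classes of elements of [Pi], in log-coordinates. *)
Definition nabla_dist (a b : 'rV[R]_n) : R :=
  Num.sqrt (\sum_(i < n) (ln (unit_rep a 0 i) - ln (unit_rep b 0 i)) ^+ 2).

(* [x] and [y] lie in the chamber of [f], at distance [r] measured there. *)
Definition chamber_dist (f : polymap k n) (x y : valclass) (r : R) : Prop :=
  exists a b, [/\ Pi_plus a, Pi_plus b,
    x = class_of (nu f a), y = class_of (nu f b) & r = nabla_dist a b].

Definition chain_lengths (x y : valclass) : set (\bar R) :=
  [set s | exists (N : nat) (z : nat -> valclass)
                  (f : nat -> polymap k n) (r : nat -> R),
     [/\ z 0%N = x, z N = y,
         forall i, (i <= N)%N -> X (z i),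
         forall i, (i < N)%N ->
           Tame (f i) /\ chamber_dist (f i) (z i) (z i.+1) (r i)
       & s = (\sum_(i < N) r i)%:E]].

Definition dX (x y : valclass) : \bar R := ereal_inf (chain_lengths x y).

End Valuations.

Section LengthSpaces.
Variables (R : realType) (T : Type) (A : set T) (d : T -> T -> \bar R).

Definition is_distance_on : Prop :=
  [/\ forall x y, A x -> A y -> (0 <= d x y < +oo)%E,
      forall x y, A x -> A y -> (d x y = 0%E <-> x = y),
      forall x y, A x -> A y -> d x y = d y x
    & forall x y z, A x -> A y -> A z -> (d x z <= d x y + d y z)%E].

Definition is_path (x y : T) (g : R -> T) : Prop :=
  [/\ g 0 = x, g 1 = y,
      forall t, t \in `[0, 1] -> A (g t)
    & forall t, t \in `[0, 1] -> forall e : R, 0 < e ->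
        exists2 h : R, 0 < h & forall s, s \in `[0, 1] ->
          `|s - t| < h -> (d (g s) (g t) < e%:E)%E].

Definition path_length (g : R -> T) : \bar R :=
  ereal_sup [set (\sum_(0 <= i < size s)
                   d (g (nth 1%R (0%R :: s) i)) (g (nth 1%R (0%R :: s) i.+1)))%E
            | s in itv_partition 0 1].

Definition is_length_space_on : Prop :=
  forall x y, A x -> A y ->
    d x y = ereal_inf [set path_length g | g in is_path x y].

End LengthSpaces.

(* Main.v *)
(* Write [x = nu_{f,a}] with [a] sorted.  Stabilizers are locally monotone: since
   only finitely many monomials have bounded [a]-weight, an automorphism that
   preserves [nu_{id,b}] with [b] close to [a] also preserves [nu_{id,a}].  Hence
   along a short chain from [x], the point of type [a] of the chambers visited is
   always [x].  The type [a] of a point is well defined, because the Jacobian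
   matrix of an automorphism is invertible, and its log-coordinates are
   1-Lipschitz along chains.  So a point at distance 0 from [x] has type [a] and
   equals [x].  The distance is finite because the classes [nu_{f,(1,...,1)}] are
   linked by chains, generator by generator.  Finally, a chain of length [s]
   yields a path of length at most [s] by joining consecutive points by straight
   segments in log-coordinates. *)
Require Import Defs.
From mathcomp Require Import all_boot all_order all_algebra.
From mathcomp Require Import all_classical all_reals all_analysis.
From mathcomp Require mpoly.
From mathcomp Require Import perm ring lra.
Import -(notations) mpoly.

Set Implicit Arguments.
Unset Strict Implicit.
Unset Printing Implicit Defensive.
Import Order.TTheory GRing.Theory Num.Theory.
Local Open Scope classical_set_scope.
Local Open Scope ring_scope.

(** * Substitution and the group of polynomial automorphisms *)

Section PolynomialMaps.
Variables (k : fieldType) (n : nat).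
Implicit Types (P Q : mpoly n k) (f g h : polymap k n).

(** Constants and variables generate the polynomial ring; this serves to prove the composition law
    and the chain rule without expanding into monomials. *)
Lemma mpoly_ring_ind (S : mpoly n k -> Prop) :
  (forall c, S (mpolyC n c)) -> (forall i, S (polyvar k i)) ->
  (forall P Q, S P -> S Q -> S (P + Q)) ->
  (forall P Q, S P -> S Q -> S (P * Q)) -> forall P, S P.
Proof.
move=> SC SX SD SM P; rewrite [P]mpolyE; apply: big_ind => //.
  exact: (SC 0).
move=> m _; rewrite -mul_mpolyC; apply: (SM _ _ (SC _)).
rewrite mpolyXE_id; apply: big_ind => //; first exact: (SC 1).
move=> i _; elim: (m i) => [|d IHd]; first by rewrite expr0 -mpolyC1.
rewrite exprS; exact: (SM _ _ (SX i) IHd).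
Qed.

Lemma pullbackC g c : pullback g (mpolyC n c) = mpolyC n c.
Proof. exact: comp_mpolyC. Qed.

Lemma pullback_var g i : pullback g (polyvar k i) = tnth g i.
Proof. by rewrite /pullback comp_mpolyXU -tnth_nth. Qed.

Lemma pullbackD g P Q : pullback g (P + Q) = pullback g P + pullback g Q.
Proof. exact: raddfD. Qed.

Lemma pullbackM g P Q : pullback g (P * Q) = pullback g P * pullback g Q.
Proof. exact: rmorphM. Qed.

Lemma pullbackZ g c P : pullback g (c *: P) = c *: pullback g P.
Proof. exact: linearZ. Qed.

Lemma pullback_id P : pullback (id_map k n) P = P.
Proof. exact: comp_mpoly_id. Qed.

(** Substitution reverses the order of composition, which makes [act] a left action. *)
Lemma pullback_comp g h P : pullback h (pullback g P) = pullback (comp_map g h) P.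
Proof.
elim/mpoly_ring_ind: P => [c|i|P Q IHP IHQ|P Q IHP IHQ].
- by rewrite !pullbackC.
- by rewrite !pullback_var tnth_mktuple.
- by rewrite !pullbackD IHP IHQ.
- by rewrite !pullbackM IHP IHQ.
Qed.

Lemma comp_mapA f g h : comp_map f (comp_map g h) = comp_map (comp_map f g) h.
Proof. by apply: eq_from_tnth => i; rewrite !tnth_mktuple pullback_comp. Qed.

Lemma comp_map_idl g : comp_map (id_map k n) g = g.
Proof. by apply: eq_from_tnth => i; rewrite !tnth_mktuple pullback_var. Qed.

Lemma comp_map_idr g : comp_map g (id_map k n) = g.
Proof. by apply: eq_from_tnth => i; rewrite !tnth_mktuple pullback_id. Qed.

Lemma mutually_inverse_sym g h : mutually_inverse g h -> mutually_inverse h g.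
Proof. by case. Qed.

Lemma mutually_inverse_comp f f' g g' : mutually_inverse f f' ->
  mutually_inverse g g' -> mutually_inverse (comp_map f g) (comp_map g' f').
Proof.
move=> [ff' f'f] [gg' g'g]; split.
  by rewrite comp_mapA -(comp_mapA f) gg' comp_map_idr.
by rewrite comp_mapA -(comp_mapA g') f'f comp_map_idr.
Qed.

Lemma pullbackK g h : mutually_inverse g h -> cancel (pullback h) (pullback g).
Proof. by move=> [_ hg] P; rewrite pullback_comp hg pullback_id. Qed.

Lemma is_subgroup_polyaut : is_subgroup_of_Aut (@is_polyaut k n).
Proof.
split=> //.
- by exists (id_map k n); split; rewrite comp_map_idl.
- move=> g h [g' gg'] [h' hh']; exists (comp_map h' g').
  exact: mutually_inverse_comp.
- by move=> g h _ gh; exists g; apply: mutually_inverse_sym.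
Qed.

Lemma linear_map1 : linear_map 1%:M = id_map k n.
Proof.
apply: eq_from_tnth => i; rewrite !tnth_mktuple (bigD1 i) //= big1.
  by rewrite addr0 mxE eqxx scale1r.
by move=> j /negPf ji; rewrite mxE eq_sym ji scale0r.
Qed.

Lemma comp_linear_map (A B : 'M[k]_n) :
  comp_map (linear_map A) (linear_map B) = linear_map (A *m B).
Proof.
apply: eq_from_tnth => i; rewrite !tnth_mktuple.
rewrite /pullback raddf_sum /=.
transitivity (\sum_(j < n) \sum_(l < n) (A i j * B j l) *: polyvar k l).
  apply: eq_bigr => j _.
  rewrite -/(pullback _ _) pullbackZ pullback_var tnth_mktuple scaler_sumr.
  by apply: eq_bigr => l _; rewrite scalerA.
by rewrite exchange_big; apply: eq_bigr => l _; rewrite mxE scaler_suml.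
Qed.

Lemma linear_map_inverse (A : 'M[k]_n) : A \in unitmx ->
  mutually_inverse (linear_map A) (linear_map (invmx A)).
Proof.
by move=> uA; split; rewrite comp_linear_map ?mulmxV ?mulVmx // linear_map1.
Qed.

Lemma pullback_elementary P Q : free_of_x1 P ->
  pullback (elementary_map Q) P = P.
Proof.
move=> freeP; rewrite [in RHS](mpolyE P) /pullback comp_mpolyEX.
apply: eq_big_seq => m mP; congr (_ *: _).
rewrite comp_mpolyX mpolyXE_id; apply: eq_bigr => i _.
rewrite tnth_mktuple; case: eqP => // i0.
by rewrite (freeP _ _ mP i0) !expr0.
Qed.

Lemma comp_elementary P Q : free_of_x1 P ->
  comp_map (elementary_map P) (elementary_map Q) = elementary_map (P + Q).
Proof.
move=> freeP; apply: eq_from_tnth => i; rewrite !tnth_mktuple.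
case: (boolP (val i == 0%N)) => i0 /=; last first.
  by rewrite pullback_var tnth_mktuple (negPf i0).
rewrite pullbackD (pullback_elementary _ freeP) pullback_var tnth_mktuple i0.
by rewrite -addrA [Q + P]addrC.
Qed.

Lemma elementary0 : elementary_map 0 = id_map k n.
Proof.
by apply: eq_from_tnth => i; rewrite !tnth_mktuple addr0; case: ifP.
Qed.

Lemma free_of_x1N P : free_of_x1 P -> free_of_x1 (- P).
Proof. by move=> freeP m i; rewrite (perm_mem (msuppN P)); apply: freeP. Qed.

Lemma elementary_inverse P : free_of_x1 P ->
  mutually_inverse (elementary_map P) (elementary_map (- P)).
Proof.
move=> freeP; have freeN := free_of_x1N freeP.
by split; rewrite comp_elementary // ?subrr ?addNr elementary0.
Qed.

(** * The tame subgroup *)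

Lemma tame_generators_polyaut : @tame_generators k n `<=` @is_polyaut k n.
Proof.
move=> _ [[A uA <-]|[P freeP <-]].
  by exists (linear_map (invmx A)); apply: linear_map_inverse.
by exists (elementary_map (- P)); apply: elementary_inverse.
Qed.

Lemma tame_generators_Tame : @tame_generators k n `<=` @Tame k n.
Proof. by move=> g gen H _; apply. Qed.

Lemma Tame_polyaut : @Tame k n `<=` @is_polyaut k n.
Proof.
by move=> f; apply; [exact: is_subgroup_polyaut|exact: tame_generators_polyaut].
Qed.

Lemma Tame_id : Tame (id_map k n).
Proof. by move=> H []. Qed.

Lemma Tame_comp g h : Tame g -> Tame h -> Tame (comp_map g h).
Proof.
move=> tg th H subH genH; have [_ _ compH _] := subH.
by apply: compH; [exact: tg|exact: th].
Qed.

Lemma Tame_inverse g h : Tame g -> mutually_inverse g h -> Tame h.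
Proof.
move=> tg gh H subH genH; have [_ _ _ invH] := subH.
by apply: invH gh; apply: tg.
Qed.

Lemma Tame_has_inverse g : Tame g -> exists2 h, Tame h & mutually_inverse g h.
Proof.
by move=> tg; have [h gh] := Tame_polyaut tg; exists h => //; apply: Tame_inverse gh.
Qed.

(** * The chain rule and Jacobian matrices *)

Lemma mderiv_pullback g P j :
  mderiv j (pullback g P) =
  \sum_(i < n) pullback g (mderiv i P) * mderiv j (tnth g i).
Proof.
elim/mpoly_ring_ind: P => [c|i|P Q IHP IHQ|P Q IHP IHQ].
- rewrite pullbackC mderivC big1 // => i _.
  by rewrite mderivC /pullback raddf0 mul0r.
- have dvar l : mderiv l (polyvar k i) = mpolyC n (i == l)%:R.
    rewrite /polyvar mderivX mnm1E; case: eqP => [->|_]; last first.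
      by rewrite scale0r mpolyC0.
    rewrite scale1r mpolyC1 -mpolyX0; congr (mpolyX k _).
    by apply/mnmP => a; rewrite mnmBE subnn mnm0E.
  rewrite pullback_var (bigD1 i) //= big1 => [|l /negPf li].
    by rewrite dvar eqxx pullbackC mpolyC1 mul1r addr0.
  by rewrite dvar eq_sym li pullbackC mpolyC0 mul0r.
- rewrite pullbackD mderivD IHP IHQ -big_split; apply: eq_bigr => i _ /=.
  by rewrite mderivD pullbackD mulrDl.
- rewrite pullbackM mderivM IHP IHQ mulr_suml mulr_sumr -big_split.
  apply: eq_bigr => i _ /=.
  rewrite mderivM pullbackD !pullbackM mulrDl -!mulrA; congr (_ + _).
  by rewrite [_ * pullback g Q]mulrC.
Qed.

Definition jacobian (g : polymap k n) (v : 'I_n -> k) : 'M[k]_n :=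
  \matrix_(i, j) meval v (mderiv j (tnth g i)).

(** By the chain rule for [comp_map h g = id_map], the Jacobian of [h] at the image of [v] is a left
    inverse. *)
Lemma jacobian_unit g v : is_polyaut g -> jacobian g v \in unitmx.
Proof.
move=> [h [_ hg]].
suff : jacobian h (fun i => meval v (tnth g i)) *m jacobian g v = 1%:M.
  by case/mulmx1_unit.
apply/matrixP => i j; rewrite !mxE.
have := congr1 (fun f => meval v (mderiv j (tnth f i))) hg.
rewrite !tnth_mktuple mderiv_pullback raddf_sum /= => dhg.
transitivity (meval v (mderiv j (polyvar k i))).
  rewrite -dhg; apply: eq_bigr => l _; rewrite !mxE rmorphM /=.
  by rewrite /pullback comp_mpoly_meval.
rewrite /polyvar mderivX mnm1E mevalZ; case: eqP => [->|_]; last first.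
  by rewrite mul0r.
rewrite mul1r mevalX big1 // => l _.
by rewrite mnmBE subnn expr0.
Qed.

(* A nonzero term in the Leibniz expansion of the Jacobian determinant gives the
   permutation. *)
Lemma polyaut_transversal g : is_polyaut g ->
  exists s : {perm 'I_n}, forall i,
    exists2 m, m \in msupp (tnth g i) & (0 < m (s i))%N.
Proof.
move=> /(jacobian_unit (fun=> 0)); rewrite unitmxE unitfE => detJ.
have [s Js] : exists s : {perm 'I_n},
    \prod_i jacobian g (fun=> 0) i (s i) != 0.
  apply: contrapT => no_s; move/eqP: detJ; apply; apply: big1 => s _.
  case: (eqVneq (\prod_i jacobian g (fun=> 0) i (s i)) 0) => [->|Js].
    by rewrite mulr0.
  by case: no_s; exists s.
exists s => i; move/prodf_neq0: Js => /(_ i isT) Ji.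
(* If no monomial of [tnth g i] involved the variable [s i], the corresponding partial derivative
   would vanish. *)
apply: contrapT => no_m; move/eqP: Ji; apply; rewrite mxE /mderiv.
rewrite big_seq big1 ?raddf0 // => m mg.
case: (posnP (m (s i))) => [->|m_gt0]; first by rewrite mul0r scale0r.
by case: no_m; exists m.
Qed.

End PolynomialMaps.

(** * Weighted degrees and equality of monomial valuations *)

Section Weights.
Variables (k : fieldType) (n : nat) (R : realType).
Implicit Types (a b : 'rV[R]_n) (m : multinom n).
Implicit Types (P Q : mpoly n k) (f g h : polymap k n).

Definition weight a (m : multinom n) : R := \sum_(i < n) a 0 i * (m i)%:R.

Lemma weight0 a : weight a (@mnm0 n) = 0.
Proof. by rewrite /weight big1 // => i _; rewrite mnm0E mulr0. Qed.

Lemma weight1 a i : weight a (mnm1 i) = a 0 i.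
Proof.
rewrite /weight (bigD1 i) //= big1 => [|j /negPf ji].
  by rewrite mnm1E eqxx mulr1 addr0.
by rewrite mnm1E eq_sym ji mulr0.
Qed.

Lemma weightD a m1 m2 : weight a (mnm_add m1 m2) = weight a m1 + weight a m2.
Proof.
rewrite /weight -big_split; apply: eq_bigr => i _ /=.
by rewrite mnmDE natrD mulrDr.
Qed.

Lemma weightZ c a m : weight (c *: a) m = c * weight a m.
Proof.
by rewrite /weight mulr_sumr; apply: eq_bigr => i _; rewrite mxE mulrA.
Qed.

Lemma weight_ge_coord a m i : Pi a -> (0 < m i)%N -> a 0 i <= weight a m.
Proof.
move=> a_gt0 mi; rewrite /weight (bigD1 i) //= -[leLHS]addr0.
apply: lerD; first by rewrite ler_peMr ?ler1n // ltW.
by apply: sumr_ge0 => j _; rewrite mulr_ge0 // ltW.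
Qed.

(** Lower bounds on [nu_id] become upper bounds on weights; the zero polynomial satisfies all of
    them, in accordance with its value [+oo]. *)
Definition wdeg_le a (c : R) P := forall m, m \in msupp P -> weight a m <= c.

Lemma wdeg_le_mono a c d P : c <= d -> wdeg_le a c P -> wdeg_le a d P.
Proof. by move=> cd leP m /leP /le_trans; apply. Qed.

Lemma wdeg_le_1 a : wdeg_le a 0 1.
Proof. by move=> m; rewrite msupp1 inE => /eqP ->; rewrite weight0. Qed.

Lemma wdeg_le_var a i : wdeg_le a (a 0 i) (polyvar k i).
Proof. by move=> m; rewrite msuppX inE => /eqP ->; rewrite weight1. Qed.

Lemma wdeg_leD a c P Q : wdeg_le a c P -> wdeg_le a c Q -> wdeg_le a c (P + Q).
Proof.
by move=> leP leQ m /msuppD_le; rewrite mem_cat => /orP[/leP|/leQ].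
Qed.

Lemma wdeg_leM a c d P Q :
  wdeg_le a c P -> wdeg_le a d Q -> wdeg_le a (c + d) (P * Q).
Proof.
move=> leP leQ m /msuppM_le /allpairsP[[m1 m2] /= [/leP le1 /leQ le2 ->]].
by rewrite weightD lerD.
Qed.

Lemma wdeg_leZ a c (u : k) P : wdeg_le a c P -> wdeg_le a c (u *: P).
Proof. by move=> leP m /msuppZ_le /leP. Qed.

Lemma wdeg_le_sum (I : eqType) (r : seq I) a c (F : I -> mpoly n k) :
  (forall i, i \in r -> wdeg_le a c (F i)) -> wdeg_le a c (\sum_(i <- r) F i).
Proof.
move=> leF; rewrite big_seq; apply: big_ind => //; last exact: wdeg_leD.
by move=> m; rewrite msupp0.
Qed.

Lemma nu_id_geP a c P : ((- c)%:E <= nu_id a P)%E <-> wdeg_le a c P.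
Proof.
rewrite /nu_id /wdeg_le; elim: (msupp P) => [|m s IHs].
  by rewrite big_nil leey; split.
rewrite big_cons le_min lee_fin lerN2; split.
  case/andP=> mc sc m'; rewrite inE => /predU1P[->//|]; exact: IHs.1 sc m'.
move=> le_ms; rewrite -/(weight a m) le_ms ?mem_head //=.
by apply: IHs.2 => m' m's; apply: le_ms; rewrite inE m's orbT.
Qed.

Lemma nu_id_gtNy a P : (-oo < nu_id a P)%E.
Proof.
rewrite /nu_id; elim: (msupp P) => [|m s IHs]; first by rewrite big_nil.
by rewrite big_cons lt_min ltNyr.
Qed.

Lemma nu_id_le a b P Q : (forall c, wdeg_le a c P -> wdeg_le b c Q) ->
  (nu_id a P <= nu_id b Q)%E.
Proof.
move=> leab; have := nu_id_gtNy a P.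
case E: (nu_id a P) => [c||] // _.
  by rewrite -[c]opprK; apply/nu_id_geP/leab/nu_id_geP; rewrite E opprK.
(* Here [nu_id a P] is [+oo], so [P] satisfies every bound; a finite value [c] of [nu_id b Q] is
   refuted by the lower bound [c + 1]. *)
have := nu_id_gtNy b Q; case F: (nu_id b Q) => [c||] // _.
suff : ((- - (c + 1))%:E <= nu_id b Q)%E.
  by rewrite F lee_fin opprK gerDl ler10.
by apply/nu_id_geP/leab/nu_id_geP; rewrite E leey.
Qed.

Lemma nu_scale f a c : 0 < c ->
  nu f (c *: a) = (fun P => c%:E * nu f a P)%E.
Proof.
move=> c_gt0; apply/funext => P; rewrite /nu /act /nu_id.
elim: (msupp _) => [|m s IHs]; first by rewrite !big_nil gt0_muley.
rewrite !big_cons IHs -/(weight a m) -/(weight (c *: a) m) weightZ.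
by rewrite mine_pMr ?lee_fin ?ltW // -EFinM mulrN.
Qed.

Lemma class_of_eqP (v w : valuation k n R) :
  class_of v = class_of w <-> exists2 c : R, 0 < c & v = (fun P => c%:E * w P)%E.
Proof.
split=> [vw|[c c_gt0 ->]].
  have : class_of v v.
    by exists 1 => //; apply/funext => P; rewrite mul1e.
  by rewrite vw.
apply/seteqP; split=> _ [d d_gt0 ->].
  exists (d * c); rewrite ?mulr_gt0 //; apply/funext => P.
  by rewrite muleA EFinM.
exists (d / c); rewrite ?divr_gt0 //; apply/funext => P.
by rewrite muleA -EFinM divfK // gt_eqF.
Qed.

Lemma class_nu_eqP f g a b : class_of (nu f a) = class_of (nu g b) <->
  exists2 c : R, 0 < c & nu f a = nu g (c *: b).
Proof.
split=> [/class_of_eqP[c c_gt0 E]|[c c_gt0 E]].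
  by exists c => //; rewrite nu_scale.
by apply/class_of_eqP; exists c => //; rewrite -nu_scale.
Qed.

(** A condition on components only, which ensures that substituting [h] turns [b]-degree at most [c]
    into [a]-degree at most [c] for all polynomials ([wdeg_le_pullback]). *)
Definition wmap_le a b h := forall i, wdeg_le a (b 0 i) (tnth h i).

Lemma wdeg_le_pullback a b c h P : wmap_le a b h ->
  wdeg_le b c P -> wdeg_le a c (pullback h P).
Proof.
move=> leh leP; rewrite /pullback comp_mpolyEX; apply: wdeg_le_sum => m mP.
apply/wdeg_leZ/(wdeg_le_mono (leP _ mP)); rewrite comp_mpolyX /weight.
apply: (big_rec2 (fun c P => wdeg_le a c P)).
  exact: wdeg_le_1.
move=> i d Q _; apply: wdeg_leM; elim: (m i) => [|j IHj].
  by rewrite expr0 mulr0; apply: wdeg_le_1.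
by rewrite exprS -natr1 mulrDr mulr1 addrC; apply: wdeg_leM.
Qed.

(** Evaluate both valuations on the components of [g']: [g] pulls them back to the variables, whose
    weights under [b] are known. *)
Lemma nu_eq_wmap_le f g g' a b : mutually_inverse g g' ->
  nu f a = nu g b -> wmap_le a b (comp_map g' f).
Proof.
move=> gg' fagb i; apply/nu_id_geP; rewrite tnth_mktuple.
rewrite -[nu_id a _]/(nu f a (tnth g' i)) fagb /nu /act -pullback_var.
by rewrite (pullbackK gg'); apply/nu_id_geP/wdeg_le_var.
Qed.

Lemma wmap_le_nu f g g' a b : mutually_inverse g g' ->
  wmap_le a b (comp_map g' f) -> forall P, (nu g b P <= nu f a P)%E.
Proof.
move=> gg' le_ab P; rewrite /nu /act; apply: nu_id_le => c lec.
have := wdeg_le_pullback le_ab lec.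
by rewrite -pullback_comp (pullbackK (mutually_inverse_sym gg')).
Qed.

(** A condition on all polynomials is reduced to inequalities on the finitely many monomials of the
    two transition maps, which can be compared for nearby weights. *)
Lemma nu_eqP f f' g g' a b : mutually_inverse f f' -> mutually_inverse g g' ->
  nu f a = nu g b <->
  wmap_le a b (comp_map g' f) /\ wmap_le b a (comp_map f' g).
Proof.
move=> ff' gg'; split=> [E|[le_ab le_ba]].
  by split; [apply: nu_eq_wmap_le gg' E|apply: nu_eq_wmap_le ff' (esym E)].
apply/funext => P; apply/eqP; rewrite eq_le.
by rewrite (wmap_le_nu ff') ?(wmap_le_nu gg').
Qed.

(* Among the [n - j] indices [i >= j] one has [s i <= j], so some monomial of
   [h_i] involves [x_{s i}], whose weight is at least that of [x_j]. *)
Lemma wmap_le_sorted a b h : is_polyaut h -> Pi_plus a -> Pi_plus b ->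
  wmap_le a b h -> forall j, a 0 j <= b 0 j.
Proof.
move=> auth [a_gt0 a_dec] [b_gt0 b_dec] leh j.
have [s s_supp] := polyaut_transversal auth.
have [i ji sij] : exists2 i : 'I_n, (j <= i)%N & (s i <= j)%N.
  (* Otherwise [s] would map the indices [i >= j] injectively into the strictly smaller set of
     indices [i > j]. *)
  apply: contrapT => no_i.
  have sub : (s @: finset (fun i : 'I_n => (j <= i)%N)
      \subset finset (fun i : 'I_n => (j < i)%N))%SET.
    apply/fintype.subsetP => _ /imsetP[i ij ->]; move: ij; rewrite !inE => ji.
    by rewrite ltnNge; apply/negP => sij; apply: no_i; exists i.
  have := subset_leq_card sub; rewrite card_imset; last exact: perm_inj.
  rewrite leqNgt => /negP; apply; apply: proper_card; apply/properP; split.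
    by apply/fintype.subsetP => i; rewrite !inE => /ltnW.
  by exists j; rewrite !inE ?ltnn ?leqnn.
have [m mh ms] := s_supp i.
apply: le_trans (b_dec _ _ ji); apply: le_trans (leh i m mh).
apply: le_trans (a_dec _ _ sij) _; exact: weight_ge_coord.
Qed.

(** The transition maps are mutually inverse automorphisms, so [wmap_le_sorted] applies in both
    directions. *)
Lemma nu_inj f g a b : Tame f -> Tame g -> Pi_plus a -> Pi_plus b ->
  nu f a = nu g b -> a = b.
Proof.
move=> /Tame_has_inverse[f' tf' ff'] /Tame_has_inverse[g' tg' gg'] a_pos b_pos.
have [[_ f'f] [_ g'g]] := (ff', gg').
have autfg : mutually_inverse (comp_map g' f) (comp_map f' g).
  by apply: mutually_inverse_comp => //; apply: mutually_inverse_sym.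
move=> /(nu_eqP _ _ ff' gg')[le_ab le_ba]; apply/rowP => j; apply/eqP.
rewrite eq_le (wmap_le_sorted _ a_pos b_pos le_ab); last by eexists; exact: autfg.
rewrite (wmap_le_sorted _ b_pos a_pos le_ba) //.
by eexists; apply: mutually_inverse_sym; exact: autfg.
Qed.

End Weights.

(** * Log-coordinates and straight segments *)

Section LogCoordinates.
Variables (n : nat) (R : realType).
Implicit Types a b : 'rV[R]_n.

Definition logc a (i : 'I_n) : R := ln (unit_rep a 0 i).

Lemma Pi_plusZ c a : 0 < c -> Pi_plus a -> Pi_plus (c *: a).
Proof.
move=> c_gt0 [a_gt0 a_dec].
by split=> [i|i j ij]; rewrite !mxE ?mulr_gt0 // ler_pM2l // a_dec.
Qed.

Lemma ln_prod (I : Type) (r : seq I) (F : I -> R) : (forall i, 0 < F i) ->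
  ln (\prod_(i <- r) F i) = \sum_(i <- r) ln (F i).
Proof.
move=> F_gt0; elim: r => [|i r IHr]; first by rewrite !big_nil ln1.
by rewrite !big_cons lnM ?posrE ?prodr_gt0 // IHr.
Qed.

Lemma unit_rep_scale a : Pi a ->
  exists2 u : R, 0 < u & unit_rep a = u *: a.
Proof.
move=> a_gt0; eexists; last by [].
by rewrite invr_gt0 powR_gt0 // prodr_gt0.
Qed.

(** The n-th root of the product is the exponential of the mean of the logarithms, so normalizing
    subtracts that mean. *)
Lemma logcE a i : Pi a -> logc a i = ln (a 0 i) - n%:R^-1 * \sum_(j < n) ln (a 0 j).
Proof.
move=> a_gt0; have prod_gt0 : 0 < \prod_(j < n) a 0 j by apply: prodr_gt0.
rewrite /logc mxE lnM ?posrE ?invr_gt0 ?powR_gt0 // lnV ?posrE ?powR_gt0 //.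
by rewrite ln_powR ln_prod // addrC.
Qed.

Lemma logcB a i j : Pi a -> logc a i - logc a j = ln (a 0 i) - ln (a 0 j).
Proof. by move=> a_gt0; rewrite !logcE // opprB addrA subrK. Qed.

Lemma logcZ c a : 0 < c -> Pi a -> logc (c *: a) =1 logc a.
Proof.
move=> c_gt0 a_gt0 i; have ca_gt0 : Pi (c *: a).
  by move=> j; rewrite mxE mulr_gt0.
have n_neq0 : n%:R != 0 :> R by rewrite pnatr_eq0 -lt0n (leq_ltn_trans _ (ltn_ord i)).
rewrite !logcE // mxE lnM ?posrE //.
under eq_bigr do rewrite mxE lnM ?posrE //.
rewrite big_split sumr_const card_ord /= -(mulr_natl (ln c)) mulrDr mulrA mulVf //.
by rewrite mul1r opprD addrACA subrr add0r.
Qed.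

Lemma logc_inj a b : Pi a -> Pi b -> logc a =1 logc b ->
  exists2 c : R, 0 < c & b = c *: a.
Proof.
move=> a_gt0 b_gt0 ab.
have [[u u_gt0 ua] [v v_gt0 vb]] := (unit_rep_scale a_gt0, unit_rep_scale b_gt0).
exists (v^-1 * u); first by rewrite mulr_gt0 ?invr_gt0.
rewrite -scalerA; have <- : v *: b = u *: a.
  apply/rowP => i; rewrite -ua -vb; apply/esym/ln_inj; last exact: ab.
    by rewrite ua mxE posrE mulr_gt0.
  by rewrite vb mxE posrE mulr_gt0.
by rewrite scalerA mulVf ?gt_eqF // scale1r.
Qed.

Lemma nabla_dist_ge a b i : `|logc a i - logc b i| <= nabla_dist a b.
Proof.
rewrite -sqrtr_sqr ler_wsqrtr // (bigD1 i) //= lerDl.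
by apply: sumr_ge0 => j _; rewrite sqr_ge0.
Qed.

Lemma nabla_dist_ge0 a b : 0 <= nabla_dist a b.
Proof. exact: sqrtr_ge0. Qed.

Lemma nabla_distC a b : nabla_dist a b = nabla_dist b a.
Proof.
by congr Num.sqrt; apply: eq_bigr => i _; rewrite -sqrrN opprB.
Qed.

(** The segment joins the logarithms themselves; as normalization only subtracts their mean, it is
    also straight in the coordinates [logc]. *)
Definition geodesic a b (t : R) : 'rV[R]_n :=
  \row_i expR ((1 - t) * ln (a 0 i) + t * ln (b 0 i)).

Lemma geodesic0 a b : Pi a -> geodesic a b 0 = a.
Proof.
move=> a_gt0; apply/rowP => i.
by rewrite mxE subr0 mul1r mul0r addr0 lnK // posrE.
Qed.

Lemma geodesic1 a b : Pi b -> geodesic a b 1 = b.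
Proof.
move=> b_gt0; apply/rowP => i.
by rewrite mxE subrr mul1r mul0r add0r lnK // posrE.
Qed.

Lemma geodesic_Pi a b t : Pi (geodesic a b t).
Proof. by move=> i; rewrite mxE expR_gt0. Qed.

Lemma geodesic_Pi_plus a b t : 0 <= t <= 1 -> Pi_plus a -> Pi_plus b ->
  Pi_plus (geodesic a b t).
Proof.
move=> /andP[t_ge0 t_le1] [a_gt0 a_dec] [b_gt0 b_dec].
split=> [|i j ij]; first exact: geodesic_Pi.
rewrite !mxE ler_expR lerD // ler_wpM2l ?subr_ge0 // ler_ln ?posrE //.
  exact: a_dec.
exact: b_dec.
Qed.

Lemma logc_geodesic a b t i : Pi a -> Pi b ->
  logc (geodesic a b t) i = (1 - t) * logc a i + t * logc b i.
Proof.
move=> a_gt0 b_gt0; rewrite !logcE //; last exact: geodesic_Pi.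
rewrite mxE expRK; under eq_bigr do rewrite mxE expRK.
rewrite big_split /= -!mulr_sumr.
ring.
Qed.

Lemma nabla_dist_geodesic a b s t : Pi a -> Pi b ->
  nabla_dist (geodesic a b s) (geodesic a b t) = `|s - t| * nabla_dist a b.
Proof.
move=> a_gt0 b_gt0; rewrite /nabla_dist -sqrtr_sqr -sqrtrM ?sqr_ge0 //.
congr Num.sqrt; rewrite mulr_sumr; apply: eq_bigr => i _.
rewrite -!/(logc _ i) !logc_geodesic //.
ring.
Qed.

End LogCoordinates.

(** * Local monotonicity of stabilizers *)

Section Stabilizers.
Variables (k : fieldType) (n : nat) (R : realType).
Implicit Types (a b : 'rV[R]_n) (h : polymap k n).

(* Only finitely many monomials have weight at most [2 * a_i]. *)
Lemma weight_gap a : Pi a -> exists2 d : R, 1 < d &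
  forall i m, a 0 i < weight a m -> d * a 0 i < weight a m.
Proof.
move=> a_gt0.
(* [B] exceeds every [2 * a 0 i / a 0 j], so a monomial of weight at most [2 * a 0 i] has all its
   exponents below [B]: a finite type covers these monomials. *)
pose S : R := \sum_i \sum_j 2 * a 0 i / a 0 j; pose B := (Num.truncn S).+1.
have B_large i j : 2 * a 0 i / a 0 j < B%:R.
  apply: le_lt_trans (truncnS_gt S).
  rewrite /S (bigD1 i) //= (bigD1 j) //= -addrA lerDl addr_ge0 //.
    by apply: sumr_ge0 => l _; rewrite divr_ge0 ?mulr_ge0 // ltW.
  by do 2![apply: sumr_ge0 => ? _]; rewrite divr_ge0 ?mulr_ge0 // ltW.
pose ratio (x : 'I_n * {ffun 'I_n -> 'I_B}) : R :=
  (\sum_(l < n) a 0 l * (x.2 l)%:R) / a 0 x.1.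
(* Midpoints between 1 and the ratios keep the final inequality strict; the default 2 handles the
   monomials of weight above [2 * a 0 i]. *)
pose d : R := \big[Order.min/2]_(x | 1 < ratio x) ((1 + ratio x) / 2).
exists d.
  rewrite /d; apply: (big_ind (fun y => 1 < y)) => [|x y x1 y1|x x1]; first by rewrite ltr1n.
    by rewrite lt_min x1.
  by rewrite ltr_pdivlMr // mul1r; lra.
move=> i m am; have [small|large] := leP (weight a m) (2 * a 0 i); last first.
  apply: le_lt_trans large; rewrite ler_pM2r // /d.
  exact: bigmin_le_id.
have m_lt j : (m j < B)%N.
  rewrite -(ltr_nat R); apply: le_lt_trans (B_large i j).
  rewrite ler_pdivlMr //; apply: le_trans small.
  rewrite /weight (bigD1 j) //= mulrC lerDl.
  by apply: sumr_ge0 => l _; rewrite mulr_ge0 // ltW.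
pose x : 'I_n * {ffun 'I_n -> 'I_B} := (i, [ffun j => Ordinal (m_lt j)]).
have xE : ratio x = weight a m / a 0 i.
  by rewrite /ratio /=; under eq_bigr do rewrite ffunE.
have x_gt1 : 1 < ratio x by rewrite xE ltr_pdivlMr // mul1r.
have dx : d <= (1 + ratio x) / 2 by apply: bigmin_le_cond.
rewrite -ltr_pdivlMr // -xE; apply: le_lt_trans dx _.
by rewrite ltr_pdivrMr //; lra.
Qed.

(** A monomial of the component [i] of [h] that is too heavy for [a] would exceed [a 0 i] by more
    than the factor [d] of the gap, but passing from [b] to [a] changes the ratios of coordinates by
    at most that factor. *)
Lemma wmap_le_near a : Pi a -> exists2 e : R, 0 < e &
  forall b h, Pi b -> (forall i, `|logc b i - logc a i| < e) ->
    wmap_le b b h -> wmap_le a a h.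
Proof.
move=> a_gt0; have [d d_gt1 gap] := weight_gap a_gt0.
have d_gt0 : 0 < d := lt_trans ltr01 d_gt1.
(* Half of [ln d], because [cmp] below compares two coordinates, each off by less than this
   radius. *)
exists (ln d / 2); first by rewrite divr_gt0 // ln_gt0.
move=> b h b_gt0 ab leh i m mh; rewrite leNgt; apply/negP => /gap.
apply/negP; rewrite -leNgt -(ler_pM2r (b_gt0 i)).
have cmp j : a 0 j * b 0 i <= d * a 0 i * b 0 j.
  rewrite -ler_ln ?posrE ?mulr_gt0 // !lnM ?posrE ?mulr_gt0 //.
  have := (logcB i j b_gt0, logcB i j a_gt0); case=> bE aE.
  have := ab i; have := ab j; rewrite !ltr_norml => /andP[? ?] /andP[? ?].
  lra.
apply: (@le_trans _ _ (d * a 0 i * weight b m)); last first.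
  by rewrite ler_pM2l ?mulr_gt0 //; apply: leh.
rewrite /weight mulr_sumr mulr_suml; apply: ler_sum => j _.
by rewrite mulrAC mulrA ler_wpM2r.
Qed.

End Stabilizers.

(** * Chains, the pseudo-distance and separation of points *)

Section Chains.
Variables (k : fieldType) (n : nat) (R : realType).
Implicit Types (a b : 'rV[R]_n) (f g h : polymap k n) (x y z : valclass k n R).

(** An inductive form of the sequences in [chain_lengths] (see [chain_lengthsE]), on which
    concatenation and reversal are plain inductions. *)
Inductive chain : valclass k n R -> valclass k n R -> R -> Prop :=
| chain_nil x : X x -> chain x x 0
| chain_cons x y z f r s : Tame f -> chamber_dist f x y r -> chain y z s ->
    chain x z (r + s).

Lemma class_nu_X f a : Tame f -> Pi a -> X (class_of (nu f a)).
Proof. by move=> tf a_gt0; exists f, a. Qed.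

Lemma chamber_distC f x y r : chamber_dist f x y r -> chamber_dist f y x r.
Proof. by move=> [a [b [? ? ? ? ->]]]; exists b, a; rewrite nabla_distC. Qed.

Lemma chamber_dist_X f x y r : Tame f -> chamber_dist f x y r -> X x /\ X y.
Proof. by move=> tf [a [b [[? _] [? _] -> -> _]]]; split; apply: class_nu_X. Qed.

Lemma chain_X x y s : chain x y s -> X x /\ X y.
Proof.
by elim=> // {}x z w f r t tf /(chamber_dist_X tf)[Xx _] _ [_ Xw].
Qed.

Lemma chain_ge0 x y s : chain x y s -> 0 <= s.
Proof.
elim=> // {}x z w f r t _ [a [b [_ _ _ _ ->]]] _ t_ge0.
by rewrite addr_ge0 // nabla_dist_ge0.
Qed.

Lemma chain_trans x y z s t : chain x y s -> chain y z t -> chain x z (s + t).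
Proof.
elim=> {x y s} [x _|x y w f r s tf xy _ IH /IH wz]; first by rewrite add0r.
by rewrite -addrA; apply: chain_cons xy wz.
Qed.

Lemma chain1 f x y r : Tame f -> chamber_dist f x y r -> chain x y r.
Proof.
move=> tf xy; rewrite -[r]addr0; apply: chain_cons (tf) (xy) _.
by apply: chain_nil; case: (chamber_dist_X tf xy).
Qed.

Lemma chain_sym x y s : chain x y s -> chain y x s.
Proof.
elim=> {x y s} [x Xx|x y w f r s tf xy _ IH]; first exact: chain_nil.
by rewrite addrC; apply: chain_trans IH (chain1 tf (chamber_distC xy)).
Qed.

Lemma chain_lengthsE x y :
  chain_lengths x y = [set s%:E | s in [set s | chain x y s]].
Proof.
apply/seteqP; split=> [_ [N [z [f [r [<- <- zX zr ->]]]]]|_ [s xys <-]].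
  eexists; last by []; elim: N z f r zX zr => [|N IHN] z f r zX zr.
    by rewrite big_ord0; apply/chain_nil/zX.
  rewrite big_ord_recl; have [tf0 z01] := zr 0%N (ltn0Sn N).
  apply: chain_cons tf0 z01 _.
  apply: (IHN (fun i => z i.+1) (fun i => f i.+1) (fun i => r i.+1)).
    by move=> i iN; apply: zX.
  by move=> i iN; apply: zr.
elim: xys => {x y s} [x Xx|x y w f r s tf xy _ [N [z [g [d [z0 zN zX zd sE]]]]]].
  exists 0%N, (fun=> x), (fun=> id_map k n), (fun=> 0).
  by split=> //; rewrite big_ord0.
exists N.+1, (fun i => if i is j.+1 then z j else x),
  (fun i => if i is j.+1 then g j else f),
  (fun i => if i is j.+1 then d j else r); split=> //.
- by case=> [_|i /zX//]; case: (chamber_dist_X tf xy).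
- by case=> [_|i /zd//]; rewrite z0.
- by rewrite big_ord_recl /= EFinD sE.
Qed.

Lemma dX_le_chain x y s : chain x y s -> (dX x y <= s%:E)%E.
Proof. by move=> xys; apply: ereal_inf_lbound; rewrite chain_lengthsE; exists s. Qed.

Lemma dX_ge x y (t : \bar R) : (forall s, chain x y s -> (t <= s%:E)%E) ->
  (t <= dX x y)%E.
Proof.
move=> le_t; apply: le_ereal_inf_tmp; rewrite chain_lengthsE => _ [s xys <-].
exact: le_t.
Qed.

Lemma dX_ge0 x y : (0 <= dX x y)%E.
Proof. by apply: dX_ge => s /chain_ge0; rewrite lee_fin. Qed.

Lemma dX_lt_chain x y (t : \bar R) : (dX x y < t)%E ->
  exists2 s, chain x y s & (s%:E < t)%E.
Proof.
rewrite /dX chain_lengthsE => /ereal_inf_lt[_ [s xys <-] st].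
by exists s.
Qed.

Lemma dX_refl x : X x -> dX x x = 0%E.
Proof.
move=> Xx; apply/eqP; rewrite eq_le dX_ge0 andbT.
exact/dX_le_chain/chain_nil.
Qed.

Lemma dX_sym x y : dX x y = dX y x.
Proof.
by apply/eqP; rewrite eq_le; apply/andP; split; apply: dX_ge => s /chain_sym;
  apply: dX_le_chain.
Qed.

Lemma dX_triangle x y z : (dX x z <= dX x y + dX y z)%E.
Proof.
(* The inequality is trivial if a term is infinite; finiteness leaves room for [e / 2] above each
   infimum. *)
have [xy|] := ltP (dX x y) +oo%E; last first.
  rewrite leye_eq => /eqP ->; rewrite addye ?leey //.
  by rewrite gt_eqF //; apply: lt_le_trans ltNy0 (dX_ge0 _ _).
have [yz|] := ltP (dX y z) +oo%E; last first.
  rewrite leye_eq => /eqP ->; rewrite addey ?leey //.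
  by rewrite gt_eqF //; apply: lt_le_trans ltNy0 (dX_ge0 _ _).
have finite (u v : valclass k n R) : (dX u v < +oo)%E -> dX u v \is a fin_num.
  by move=> uv; rewrite ge0_fin_numE //; apply: dX_ge0.
apply/lee_addgt0Pr => e e_gt0.
have e2_gt0 : 0 < e / 2 by rewrite divr_gt0.
have [s xys ltxy] : exists2 s, chain x y s & (s%:E < dX x y + (e / 2)%:E)%E.
  by apply: dX_lt_chain; rewrite lteDl ?finite.
have [t yzt ltyz] : exists2 t, chain y z t & (t%:E < dX y z + (e / 2)%:E)%E.
  by apply: dX_lt_chain; rewrite lteDl ?finite.
apply: le_trans (dX_le_chain (chain_trans xys yzt)) _.
rewrite [e in leRHS]splitr EFinD EFinD addeACA.
by apply: leeD; apply: ltW.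
Qed.

(* While a chain starting at a point of type [a0] stays shorter than the radius
   [e] given by [wmap_le_near], the point of type [a0] of the current chamber
   does not change. *)
Lemma chain_near a0 e : Pi a0 ->
  (forall b h, Pi b -> (forall i, `|logc b i - logc a0 i| < e) ->
    wmap_le b b h -> wmap_le a0 a0 h) ->
  forall x y s, chain x y s -> forall f a t, Tame f -> Pi_plus a ->
    x = class_of (nu f a) -> (forall i, `|logc a i - logc a0 i| <= t) ->
    t + s < e ->
    exists g b, [/\ Tame g, Pi_plus b, y = class_of (nu g b),
      forall i, `|logc b i - logc a0 i| <= t + s & nu f a0 = nu g a0].
Proof.
move=> a0_gt0 near x y s.
elim=> {x y s} [x _|x y z f1 r s tf1 xy yzs IH] f a t tf pa xE at0 ts_lt.
  by exists f, a; split=> // i; rewrite addr0.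
case: xy xE => a1 [b1 [pa1 pb1 -> yE rE]] /esym/class_nu_eqP[c c_gt0 E].
have [[a_gt0 _] [a1_gt0 _]] := (pa, pa1).
(* The point [x] is written in two chambers; its sorted weights there agree up to the scalar [c]. *)
have aE := nu_inj tf tf1 pa (Pi_plusZ c_gt0 pa1) E; rewrite -aE in E.
have logaE i : logc a1 i = logc a i by rewrite aE logcZ.
have r_ge0 : 0 <= r by rewrite rE nabla_dist_ge0.
have s_ge0 := chain_ge0 yzs.
have near_a i : `|logc a i - logc a0 i| < e.
  by apply: le_lt_trans (at0 i) _; apply: le_lt_trans ts_lt; lra.
(* The transition maps between the two chambers respect the weight [a], hence also [a0] by
   [near]. *)
have ff1 : nu f a0 = nu f1 a0.
  have [f' _ ff'] := Tame_has_inverse tf.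
  have [f1' _ ff1'] := Tame_has_inverse tf1.
  case/(nu_eqP _ _ ff' ff1'): E => le1 le2; apply/(nu_eqP _ _ ff' ff1').
  by split; [exact: near le1|exact: near le2].
have [||g [b [tg pb zE bt gE]]] := IH f1 b1 (t + r) tf1 pb1 yE.
- move=> i; rewrite -(subrKA (logc a i)); apply: le_trans (ler_normD _ _) _.
  rewrite addrC; apply: lerD; first exact: at0.
  by rewrite -logaE distrC rE; apply: nabla_dist_ge.
- by rewrite -addrA.
exists g, b; split; [exact: tg|exact: pb|exact: zE| |by rewrite ff1].
by move=> i; rewrite addrA; apply: bt.
Qed.

(* Both chains below start at [x]; the second one is arbitrarily short and shows
   that [y] also has type [a]. *)
Lemma dX_sep f a y : Tame f -> Pi_plus a -> dX (class_of (nu f a)) y = 0%E ->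
  class_of (nu f a) = y.
Proof.
move=> tf pa xy0; have [a_gt0 _] := pa.
have [e e_gt0 near] := wmap_le_near k a_gt0.
have short d : 0 < d -> d <= e -> exists g b, [/\ Tame g, Pi_plus b,
    y = class_of (nu g b), forall i, `|logc b i - logc a i| <= d &
    nu f a = nu g a].
  move=> d_gt0 de; have [s xys sd] : exists2 s,
      chain (class_of (nu f a)) y s & (s%:E < d%:E)%E.
    by apply: dX_lt_chain; rewrite xy0 lte_fin.
  rewrite lte_fin in sd.
  have [||g [b [tg pb yE bs gE]]] :=
      chain_near a_gt0 near xys tf pa erefl (t := 0).
  - by move=> i; rewrite subrr normr0.
  - by rewrite add0r (lt_le_trans sd).
  exists g, b; split; [exact: tg|exact: pb|exact: yE| |exact: gE].
  by move=> i; apply: le_trans (bs i) _; rewrite add0r ltW.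
have [g [b [tg pb yE _ gE]]] := short e e_gt0 (lexx _).
have [b_gt0 _] := pb.
suff : logc a =1 logc b.
  move=> /(logc_inj a_gt0 b_gt0)[c c_gt0 bE].
  rewrite yE; apply/esym/class_of_eqP; exists c; first exact: c_gt0.
  by rewrite bE gE nu_scale.
move=> i; apply/eqP; rewrite eq_sym -subr_eq0 -normr_le0.
apply/ler_addgt0Pr => d d_gt0; rewrite add0r.
have [||g' [b' [tg' pb' yE' b's _]]] := short (Num.min d e).
- by rewrite lt_min d_gt0.
- by rewrite ge_min lexx orbT.
(* The log-coordinates of [y] do not depend on the chamber in which it is written. *)
have -> : logc b i = logc b' i.
  move: yE; rewrite yE' => /class_nu_eqP[c c_gt0 E].
  by rewrite (nu_inj tg' tg pb' (Pi_plusZ c_gt0 pb) E) logcZ.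
by apply: le_trans (b's i) _; rewrite ge_min lexx.
Qed.

End Chains.

(** * Covering by chambers and existence of chains *)

Section Connectedness.
Variables (k : fieldType) (n : nat) (R : realType).
Implicit Types (a b : 'rV[R]_n) (P : mpoly n k) (f g h : polymap k n).
Implicit Types x y z : valclass k n R.

(** [f] carries [nu_id b] to [nu_id a]; then let [g] act on both. *)
Lemma nu_comp_stable f f' g a b : mutually_inverse f f' ->
  wmap_le b a f -> wmap_le a b f' -> nu (comp_map g f) b = nu g a.
Proof.
move=> ff' lef lef'.
have fE : nu f b = nu (id_map k n) a.
  have id_inv : mutually_inverse (id_map k n) (id_map k n).
    by split; rewrite comp_map_idl.
  by apply/(nu_eqP _ _ ff' id_inv); rewrite comp_map_idl comp_map_idr.
apply/funext => P; rewrite /nu /act -pullback_comp.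
rewrite -[LHS]/(nu f b (pullback g P)) fE /nu /act.
by rewrite pullback_id.
Qed.

Lemma wmap_le_linear (A : 'M[k]_n) a b :
  (forall i j, A i j != 0 -> a 0 j <= b 0 i) -> wmap_le a b (linear_map A).
Proof.
move=> leA i; rewrite tnth_mktuple; apply: wdeg_le_sum => j _.
have [->|/leA Aij] := eqVneq (A i j) 0.
  by rewrite scale0r => m; rewrite msupp0.
exact/wdeg_leZ/(wdeg_le_mono Aij)/wdeg_le_var.
Qed.

Lemma perm_mx_neq0 (s : {perm 'I_n}) i j : (perm_mx s i j : k) != 0 -> s i = j.
Proof. by rewrite !mxE; case: (s i =P j) => // _ /eqP[]. Qed.

Lemma sort_Pi a : Pi a -> exists2 b, Pi_plus b &
  exists s : {perm 'I_n}, forall i, b 0 i = a 0 (s i).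
Proof.
move=> a_gt0; pose t := [tuple a 0 i | i < n].
have sort_perm : perm_eq (sort (fun u v : R => v <= u) t) t by rewrite perm_sort.
have [s tE] := tuple_permP sort_perm.
have bE (i : 'I_n) : nth 0 (sort (fun u v : R => v <= u) t) i = a 0 (s i).
  by rewrite tE (nth_map i) ?size_enum_ord // tnth_mktuple nth_ord_enum.
exists (\row_i a 0 (s i)); last by exists s => i; rewrite mxE.
split=> [i|i j ij]; first by rewrite mxE.
rewrite !mxE -!bE.
have ge_trans : transitive (fun u v : R => v <= u).
  by move=> u v w vu wv; apply: le_trans wv vu.
apply: (sorted_leq_nth ge_trans (fun u => lexx u)) => //.
- by apply: sort_sorted => u v; apply: le_total.
- by rewrite inE size_sort size_tuple.
- by rewrite inE size_sort size_tuple.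
Qed.

(** Sort the weight by permuting the variables, and absorb the permutation matrix, which is tame,
    into [f]. *)
Lemma chamber_cover x : X x ->
  exists f a, [/\ Tame f, Pi_plus a & x = class_of (nu f a)].
Proof.
move=> [f [a [tf a_gt0 ->]]]; have [b pb [s bE]] := sort_Pi a_gt0.
pose L (t : {perm 'I_n}) := linear_map (perm_mx t : 'M[k]_n).
have inv_s : mutually_inverse (L s^-1%g) (L s).
  by split; rewrite comp_linear_map -perm_mxM ?mulVg ?mulgV perm_mx1 linear_map1.
exists (comp_map f (L s^-1%g)), b; split=> //.
  apply: Tame_comp tf _; apply: tame_generators_Tame; left.
  by exists (perm_mx s^-1%g) => //; apply: unitmx_perm.
congr class_of; symmetry; apply: (nu_comp_stable _ inv_s).
  by apply: wmap_le_linear => i j /perm_mx_neq0 <-; rewrite bE permKV.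
by apply: wmap_le_linear => i j /perm_mx_neq0 <-; rewrite bE.
Qed.

(** For equal weights the weight is the total degree, which invertible linear maps preserve; hence
    linear generators do not move these points. *)
Definition base f : valclass k n R := class_of (nu f (const_mx 1)).

Lemma Pi_plus1 : Pi_plus (const_mx 1 : 'rV[R]_n).
Proof. by split=> [i|i j _]; rewrite !mxE ?ltr01 ?lexx. Qed.

Lemma chain_chamber f a b : Tame f -> Pi_plus a -> Pi_plus b ->
  exists s, chain (class_of (nu f a)) (class_of (nu f b)) s.
Proof.
move=> tf pa pb; exists (nabla_dist a b); apply: chain1 (tf) _.
by exists a, b.
Qed.

Lemma wmap_le_elementary P a : free_of_x1 P ->
  (forall i, val i = 0%N -> wdeg_le a (a 0 i) P) -> wmap_le a a (elementary_map P).
Proof.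
move=> freeP leP i; rewrite tnth_mktuple; case: eqP => [i0|_].
  by apply: wdeg_leD (leP _ i0); apply: wdeg_le_var.
exact: wdeg_le_var.
Qed.

(* With [x_1] heavier than [P], the elementary map fixes [nu_{id,a}], and this
   class lies in both chambers. *)
Lemma base_elementary P g : free_of_x1 P -> Tame g ->
  exists s, chain (base g) (base (comp_map g (elementary_map P))) s.
Proof.
(* Total degrees in [P] are below [msize P], and they bound the [a]-weights since [x_1] does not
   occur in [P]; the successor keeps [M >= 1] when [P = 0]. *)
move=> freeP tg; pose M : R := (msize P).+1%:R.
have M_ge1 : 1 <= M by rewrite ler1n.
pose a : 'rV[R]_n := \row_i (if val i == 0%N then M else 1).
have pa : Pi_plus a.
  split=> [i|i j ij]; rewrite !mxE.
    by case: ifP => // _; apply: lt_le_trans M_ge1.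
  case: (val j =P 0%N) => j0; case: (val i =P 0%N) => // i0.
  by case: i0; apply/eqP; rewrite -leqn0 -j0.
have weight_le m i : val i = 0%N -> m \in msupp P -> weight a m <= a 0 i.
  move=> i0 mP; rewrite mxE i0 eqxx.
  apply: (@le_trans _ _ (mdeg m)%:R); last first.
    by rewrite ler_nat ltnW // ltnW // ltnS msize_mdeg_lt.
  rewrite mdegE natr_sum; apply: ler_sum => j _; rewrite mxE.
  by case: eqP => [j0|_]; rewrite ?mul1r // (freeP _ _ mP j0) mulr0.
have stable : nu (comp_map g (elementary_map P)) a = nu g a.
  apply: (nu_comp_stable _ (elementary_inverse freeP)).
    by apply: wmap_le_elementary freeP _ => i i0 m; apply: weight_le.
  apply: wmap_le_elementary (free_of_x1N freeP) _ => i i0 m.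
  by rewrite (perm_mem (msuppN P)); apply: weight_le.
have tgP : Tame (comp_map g (elementary_map P)).
  by apply: Tame_comp tg _; apply: tame_generators_Tame; right; exists P.
have [s chain_s] := chain_chamber tg Pi_plus1 pa.
have [t chain_t] := chain_chamber tgP pa Pi_plus1.
exists (s + t); apply: chain_trans chain_s _.
by rewrite stable in chain_t.
Qed.

(** The tame maps [f] with this property form a subgroup containing the generators; quantifying over
    all [g] gives stability under composition and inversion. *)
Lemma base_comp f : Tame f -> forall g, Tame g ->
  exists s, chain (base g) (base (comp_map g f)) s.
Proof.
move=> tf; suff [] : Tame f /\ forall g, Tame g ->
  exists s, chain (base g) (base (comp_map g f)) s by [].
apply: (tf [set f | Tame f /\ forall g, Tame g ->
  exists s, chain (base g) (base (comp_map g f)) s]).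
  split=> /=.
  - by move=> h [th _]; apply: Tame_polyaut.
  - split=> [|g tg]; first exact: Tame_id.
    exists 0; rewrite comp_map_idr; apply: chain_nil.
    by apply: class_nu_X tg _; case: Pi_plus1.
  - move=> f1 f2 [tf1 H1] [tf2 H2]; split=> [|g tg]; first exact: Tame_comp.
    have [s chain_s] := H1 g tg.
    have [t chain_t] := H2 _ (Tame_comp tg tf1).
    by exists (s + t); rewrite comp_mapA; apply: chain_trans chain_s chain_t.
  - move=> f1 f2 [tf1 H1] f12; have tf2 := Tame_inverse tf1 f12.
    split=> [|g tg]; first exact: tf2.
    (* Since [f2] inverts [f1], the property of [f1] at [comp_map g f2] links this map back to
       [g]. *)
    have [s chain_s] := H1 _ (Tame_comp tg tf2).
    exists s; apply: chain_sym; move: chain_s.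
    by case: f12 => _ f21; rewrite -comp_mapA f21 comp_map_idr.
move=> h gen_h; split; first exact: tame_generators_Tame.
move=> g tg; case: gen_h => [[A uA <-]|[P freeP <-]]; last exact: base_elementary.
exists 0; rewrite /base (nu_comp_stable (a := const_mx 1) _ (linear_map_inverse uA)).
- by apply: chain_nil; apply: class_nu_X tg _; case: Pi_plus1.
- by apply: wmap_le_linear => i j _; rewrite !mxE.
- by apply: wmap_le_linear => i j _; rewrite !mxE.
Qed.

Lemma chain_exists x y : X x -> X y -> exists s, chain x y s.
Proof.
have to_base z : X z -> exists s, chain (base (id_map k n)) z s.
  move=> /chamber_cover[f [a [tf pa ->]]].
  have [s chain_s] := base_comp tf (@Tame_id k n).
  have [t chain_t] := chain_chamber tf Pi_plus1 pa.
  exists (s + t); apply: chain_trans chain_s _.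
  by rewrite comp_map_idl.
move=> /to_base[s chain_s] /to_base[t chain_t].
by exists (s + t); apply: chain_trans (chain_sym chain_s) chain_t.
Qed.

Lemma dX_lty x y : X x -> X y -> (dX x y < +oo)%E.
Proof.
move=> Xx Xy; have [s xys] := chain_exists Xx Xy.
by apply: le_lt_trans (dX_le_chain xys) _; apply: ltry.
Qed.

End Connectedness.

(** * From chains to paths of controlled length *)

Section LengthSpace.
Variables (k : fieldType) (n : nat) (R : realType).
Implicit Types (a b : 'rV[R]_n) (f g h : polymap k n).
Implicit Types x y z : valclass k n R.

Lemma class_nu_nabla0 f a b : Pi a -> Pi b -> nabla_dist a b = 0 ->
  class_of (nu f a) = class_of (nu f b).
Proof.
move=> a_gt0 b_gt0 ab0.
have [c c_gt0 ->] : exists2 c : R, 0 < c & a = c *: b.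
  apply: logc_inj => // i; apply/eqP; rewrite eq_sym -subr_eq0 -normr_le0 -ab0.
  exact: nabla_dist_ge.
by apply/class_nu_eqP; exists c.
Qed.

(** This is parametrization by arc length: each step of the chain becomes a straight segment run at
    unit speed, and the segments are glued end to end. *)
Lemma chain_path x y s : chain x y s -> exists g : R -> valclass k n R,
  [/\ g 0 = x, g s = y &
      forall t u : R, 0 <= t -> t <= u -> u <= s -> chain (g t) (g u) (u - t)].
Proof.
elim=> {x y s} [x Xx|x y z f r s tf xy yz [g [g0 gs gchain]]].
  exists (fun=> x); split=> // t u t_ge0 tu u_le0.
  have -> : u - t = 0 by lra.
  exact: chain_nil.
case: xy => a [b [pa pb xE yE rE]]; have [[a_gt0 _] [b_gt0 _]] := (pa, pb).
have r_ge0 : 0 <= r by rewrite rE nabla_dist_ge0.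
have s_ge0 := chain_ge0 yz.
pose q t := class_of (nu f (geodesic a b (t / r))) : valclass k n R.
have q0 : q 0 = x by rewrite /q mul0r geodesic0.
have qr : q r = y.
  (* For [r = 0] the quotient [t / r] is 0 and [q] is constant; it still ends at [y], as points of a
     chamber at distance 0 coincide. *)
  rewrite /q; case: (eqVneq r 0) => [r0|r_neq0]; last first.
    by rewrite divff // geodesic1.
  by rewrite r0 mul0r geodesic0 // yE; apply: class_nu_nabla0; rewrite -?rE.
have qchain t u : 0 <= t -> t <= u -> u <= r -> chain (q t) (q u) (u - t).
  move=> t_ge0 tu ur; apply: (chain1 tf).
  exists (geodesic a b (t / r)), (geodesic a b (u / r)).
  have unit_itv v : 0 <= v -> v <= r -> 0 <= v / r <= 1.
    move=> v_ge0 vr; rewrite divr_ge0 //=.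
    move: r_ge0; rewrite le_eqVlt => /predU1P[<-|r_gt0].
      by rewrite invr0 mulr0.
    by rewrite ler_pdivrMr // mul1r.
  split.
  - by apply: geodesic_Pi_plus => //; apply: unit_itv => //; lra.
  - by apply: geodesic_Pi_plus => //; apply: unit_itv => //; lra.
  - by [].
  - by [].
  - rewrite nabla_dist_geodesic // -rE distrC -mulrBl normrM normfV.
    rewrite (ger0_norm r_ge0) ger0_norm ?subr_ge0 //.
    have [r0|r_neq0] := eqVneq r 0; last by rewrite divfK.
    by rewrite r0 mulr0; lra.
exists (fun t => if t <= r then q t else g (t - r)); split.
- by rewrite r_ge0.
- case: ifP => [sr|_]; last by rewrite addrC addKr.
  (* The first branch is taken at time [r + s] only if [s = 0], and then [g] starts and ends at the
     same point. *)
  have s0 : s = 0 by lra.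
  by rewrite s0 addr0 qr -g0 -gs s0.
move=> t u t_ge0 tu us; have [ur|ru] := leP u r.
  by rewrite (le_trans tu ur); apply: qchain.
have [tr|rt] := leP t r; last first.
  have -> : u - t = (u - r) - (t - r) by lra.
  by apply: gchain; lra.
(* Cut at the time [r] of the junction point [y]. *)
have -> : u - t = (r - t) + (u - r) by lra.
apply: chain_trans (qchain _ _ t_ge0 tr (lexx _)) _.
rewrite qr -g0 -[X in chain _ _ X]subr0.
by apply: gchain; lra.
Qed.

(** The partition into a single interval already contributes the distance between the endpoints. *)
Lemma path_length_ge x y (g : R -> valclass k n R) : is_path (@X k n R) (@dX k n R) x y g ->
  (dX x y <= path_length (@dX k n R) g)%E.
Proof.
move=> [<- <- _ _]; apply: ereal_sup_ubound; exists [:: 1].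
  exact: itv_partition1 ltr01.
by rewrite big_nat1.
Qed.

Lemma path_length_lipschitz (g : R -> valclass k n R) (L : R) :
  (forall t u : R, 0 <= t -> t <= u -> u <= 1 ->
    (dX (g t) (g u) <= (L * (u - t))%:E)%E) ->
  (path_length (@dX k n R) g <= L%:E)%E.
Proof.
move=> lip; apply: ge_ereal_sup => _ [s sp <-].
(* The left endpoint is generalized for an induction on the partition, along which the bounds
   telescope. *)
suff gen (t : R) : 0 <= t -> itv_partition t 1 s ->
    (\sum_(0 <= i < size s)
      dX (g (nth 1%R (t :: s) i)) (g (nth 1%R (t :: s) i.+1)) <=
    (L * (1 - t))%:E)%E.
  by have := gen 0 (lexx _) sp; rewrite subr0 mulr1.
elim: s {sp} t => [|u s IHs] t t_ge0 sp.
  by rewrite big_geq // (itv_partition_nil sp) subrr mulr0.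
have tu : t <= u by case: sp => /= /andP[/ltW].
have sp' := itv_partition_cons sp; have u_le1 := itv_partition_le sp'.
rewrite big_nat_recl //=.
have -> : L * (1 - t) = L * (u - t) + L * (1 - u) by ring.
rewrite EFinD; apply: leeD; first exact: lip.
by apply: IHs => //; apply: le_trans tu.
Qed.

Lemma chain_is_path x y s : chain x y s -> exists2 g : R -> valclass k n R,
  is_path (@X k n R) (@dX k n R) x y g & (path_length (@dX k n R) g <= s%:E)%E.
Proof.
move=> xys; have [g [g0 gs gchain]] := chain_path xys.
have s_ge0 := chain_ge0 xys.
have lip (t u : R) : 0 <= t -> t <= u -> u <= 1 ->
    (dX (g (s * t)%R) (g (s * u)%R) <= (s * (u - t))%:E)%E.
  move=> t_ge0 tu u_le1; rewrite mulrBr; apply/dX_le_chain/gchain.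
  - by rewrite mulr_ge0.
  - by rewrite ler_wpM2l.
  - by rewrite ler_piMr.
exists (fun t => g (s * t)); last exact: path_length_lipschitz.
split; rewrite ?mulr0 ?mulr1 // => t; rewrite in_itv /= => /andP[t_ge0 t_le1].
  have /chain_X[] // : chain (g (s * t)) (g (s * t)) (s * t - s * t).
  by apply: gchain => //; [rewrite mulr_ge0|rewrite ler_piMr].
move=> e e_gt0; have s1_gt0 : 0 < s + 1 by rewrite ltr_wpDl.
(* The Lipschitz constant [s] may be 0, hence the division by [s + 1]. *)
exists (e / (s + 1)); first by rewrite divr_gt0.
move=> u; rewrite in_itv /= => /andP[u_ge0 u_le1]; rewrite ltr_pdivlMr // => ut.
apply: (@le_lt_trans _ _ (s * `|u - t|)%:E).
  have [tu|/ltW ut'] := leP t u.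
    by rewrite dX_sym ger0_norm ?subr_ge0 //; apply: lip.
  by rewrite distrC ger0_norm ?subr_ge0 //; apply: lip.
rewrite lte_fin; apply: le_lt_trans ut.
by rewrite mulrC ler_wpM2l // lerDl ler01.
Qed.

End LengthSpace.

Theorem proposition5p4 (k : fieldType) (n : nat) (R : realType) (hn : (2 <= n)%N) :
  is_distance_on (@X k n R) (@dX k n R) /\
  is_length_space_on (@X k n R) (@dX k n R).
Proof.
split.
  split=> [x y Xx Xy|x y Xx Xy|x y _ _|x y z _ _ _].
  - by rewrite dX_ge0 dX_lty.
  - split=> [|<-]; last exact: dX_refl.
    by have [f [a [tf pa ->]]] := chamber_cover Xx; apply: dX_sep.
  - exact: dX_sym.
  - exact: dX_triangle.
move=> x y Xx Xy; apply/eqP; rewrite eq_le; apply/andP; split.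
  by apply: le_ereal_inf_tmp => _ [g pg <-]; apply: path_length_ge.
apply: dX_ge => s /chain_is_path[g pg gs].
by apply: ge_ereal_inf; exists (path_length (@dX k n R) g) => //; exists g.
Qed.
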